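(* Let $K\ge1$ and $\alpha\in(0,1)$, and let $\mathcal G:[0,\infty]^K\to2^{\mathcal K}$ be an e-testing procedure that is self-consistent at level $\alpha$. Then for arbitrary configurations of e-values, i.e. for any set $\mathcal N\subseteq\mathcal K$ of true null indices with $K_0=|\mathcal N|$ and any random vector $\mathbf E=(E_1,\dots,E_K)$ with values in $[0,\infty]^K$ such that $\mathbb E[E_k]\le1$ for all $k\in\mathcal N$ (with arbitrary dependence), $$\mathbb E\left[\frac{F_{\mathcal G}}{R_{\mathcal G}}\right]\le\frac{\alpha K_0}{K}.$$
   Context: $\mathcal K=\{1,\dots,K\}$ indexes hypotheses $H_1,\dots,H_K$; $\mathcal N\subseteq\mathcal K$ is the set of indices of true null hypotheses. An e-testing procedure is a Borel function $\mathcal G:[0,\infty]^K\to2^{\mathcal K}$ giving the set of indices of rejected hypotheses from observed e-values $(e_1,\dots,e_K)$. It is self-consistent at level $\alpha$ if, for every input $(e_1,\dots,e_K)$, every rejected index $k$ satisfies $e_k\ge\frac{K}{\alpha R_{\mathcal G}}$, where $R_{\mathcal G}$ is the number of rejections for that input. With $\mathcal G$ evaluated at $\mathbf E$, $R_{\mathcal G}=|\mathcal G(\mathbf E)|$, $F_{\mathcal G}=|\mathcal G(\mathbf E)\cap\mathcal N|$, and $0/0=0$. *)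

(* Defs.v *)
From HB Require Import structures.
From mathcomp Require Import all_boot all_order all_algebra.
From mathcomp Require Import all_classical all_reals all_analysis.
From mathcomp Require Import measurable_realfun.

Set Implicit Arguments.
Unset Strict Implicit.
Unset Printing Implicit Defensive.

Import Order.TTheory GRing.Theory Num.Theory.

Local Open Scope classical_set_scope.
Local Open Scope ring_scope.

HB.instance Definition _ (T : finType) := isPointed.Build {set T} finset.set0.

HB.instance Definition _ (T : finType) :=
  @isMeasurable.Build default_measure_display {set T} discrete_measurable
    discrete_measurable0 discrete_measurableC discrete_measurableU.

(* [0, +oo]^K inside [-oo, +oo]^K.  The sigma-algebra on K.-tuple (\bar R) is
   generated by the K coordinate maps, hence is the Borel one. *)
Definition e_values (R : realType) (K : nat) : set (K.-tuple (\bar R)) :=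
  [set e | forall k : 'I_K, (0 <= tnth e k)%E].
Arguments e_values R K : clear implicits.

(* Guards against a pitfall: [measurable_fun D f] takes [measurable D] as a
   premise, so it would be void on a non-measurable domain. *)
Lemma measurable_e_values (R : realType) (K : nat) : measurable (e_values R K).
Proof.
have -> : e_values R K = \bigcap_(k in [set: 'I_K])
    ((fun e : K.-tuple (\bar R) => tnth e k) @^-1` [set x | (0 <= x)%E]).
  by apply/seteqP; split=> [e h k _|e h k]; [exact: h | exact: (h k I)].
apply: fin_bigcap_measurable => [|k _]; first exact: finite_finset.
rewrite -[X in measurable X]setTI; apply: (measurable_tnth k) => //.
rewrite (_ : [set x | _] = `[0%E, +oo[%classic); first exact: emeasurable_itv.
by apply/seteqP; split=> x /=; rewrite in_itv /= andbT.
Qed.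

(* Hypotheses are indexed from 0.  A function on [0, +oo]^K is a total function
   on K.-tuple (\bar R) whose values off [e_values R K] are irrelevant. *)
Definition e_testing_procedure (R : realType) (K : nat)
    (G : K.-tuple (\bar R) -> {set 'I_K}) : Prop :=
  measurable_fun (e_values R K) G.

Definition self_consistent (R : realType) (K : nat) (alpha : R)
    (G : K.-tuple (\bar R) -> {set 'I_K}) : Prop :=
  forall e, e_values R K e -> forall k : 'I_K, k \in G e ->
    ((K%:R / (alpha * #|G e|%:R))%:E <= tnth e k)%E.

(* The value is 0 when nothing is rejected, since x / 0 = 0 in a field. *)
Definition false_discovery_proportion (R : realType) (K : nat)
    (N rejected : {set 'I_K}) : R :=
  #|rejected :&: N|%:R / #|rejected|%:R.
Arguments false_discovery_proportion R {K} N rejected.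

(* Main.v *)
(** Self-consistency says that [1 / R <= (alpha / K) * e_k] for each rejected
    [k], where [R] is the number of rejections.  Summing over the rejected true
    nulls bounds [F / R] pointwise by [(alpha / K) * \sum_(k in N) e_k], a sum
    whose expectation is at most [alpha * K_0 / K] under any dependence. *)
Require Import Defs.
From mathcomp Require Import all_boot all_order all_algebra.
From mathcomp Require Import all_classical all_reals all_analysis.
From mathcomp Require Import measurable_realfun.

Import Order.TTheory GRing.Theory Num.Theory.

Local Open Scope classical_set_scope.
Local Open Scope ring_scope.

(** The sigma-algebra on [{set I}] is discrete, so every preimage is measurable by computation.
    Measurability of the false discovery proportion thus reduces to that of [G \o E]. *)
Lemma measurable_fun_finset (I : finType) d (U : measurableType d)
  (D : set {set I}) (h : {set I} -> U) : measurable_fun D h.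
Proof. by []. Qed.

(** Each rejected null carries weight [1 / #|A|]. Summing over the fixed [N], rather than the random
    rejected set, permits a termwise bound that can be integrated. *)
Lemma false_discovery_proportion_sum (R : realType) (K : nat)
    (N A : {set 'I_K}) :
  false_discovery_proportion R N A =
  \sum_(k in N) (if k \in A then #|A|%:R^-1 else 0).
Proof.
rewrite -big_mkcondr /= sumr_const -[RHS]mulr_natl /false_discovery_proportion.
by congr (_%:R / _); apply: eq_card => k; rewrite inE andbC.
Qed.

Lemma self_consistent_inv_le (R : realType) (K : nat) (alpha : R)
    (G : K.-tuple (\bar R) -> {set 'I_K}) (e : K.-tuple (\bar R)) (k : 'I_K) :
  0 < alpha -> self_consistent alpha G -> e_values R K e -> k \in G e ->
  ((#|G e|%:R^-1)%:E <= (alpha / K%:R)%:E * tnth e k)%E.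
Proof.
move=> alpha0 hG he kG.
(* The index [k] forces [K > 0] and [kG] forces a rejection, so no inverse below takes its default
   value. *)
have K0 : 0 < K%:R :> R by rewrite ltr0n (leq_trans _ (ltn_ord k)).
have r0 : 0 < #|G e|%:R :> R by rewrite ltr0n; apply/card_gt0P; exists k.
apply: le_trans (lee_wpmul2l _ (hG _ he _ kG)); last first.
  by rewrite lee_fin divr_ge0 // ltW.
rewrite -EFinM lee_fin invfM mulrA divfK ?gt_eqF//.
by rewrite mulrA divff ?gt_eqF// mul1r.
Qed.

Lemma false_discovery_proportion_le (R : realType) (K : nat) (alpha : R)
    (G : K.-tuple (\bar R) -> {set 'I_K}) (N : {set 'I_K})
    (e : K.-tuple (\bar R)) :
  0 < alpha -> self_consistent alpha G -> e_values R K e ->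
  ((false_discovery_proportion R N (G e))%:E <=
     \sum_(k in N) (alpha / K%:R)%:E * tnth e k)%E.
Proof.
move=> alpha0 hG he.
rewrite false_discovery_proportion_sum -sumEFin; apply: lee_sum => k _.
(* A null that is not rejected contributes 0 against a nonnegative term. *)
case: ifPn => [kG|_]; first exact: self_consistent_inv_le.
by rewrite mule_ge0 ?lee_fin ?divr_ge0 // ltW.
Qed.

Theorem proposition2 (R : realType) (K : nat) (hK : (1 <= K)%N)
    (alpha : R) (halpha : 0 < alpha < 1)
    (G : K.-tuple (\bar R) -> {set 'I_K})
    (hG : e_testing_procedure G) (hGsc : self_consistent alpha G)
    (N : {set 'I_K})
    (d : measure_display) (T : measurableType d) (P : probability T R)
    (E : {RV P >-> K.-tuple (\bar R)})
    (hE : forall w : T, e_values R K (E w))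
    (hEnull : forall k : 'I_K, k \in N -> (\int[P]_w tnth (E w) k <= 1)%E) :
  ('E_P[(fun w => false_discovery_proportion R N (G (E w)))]
     <= (alpha * #|N|%:R / K%:R)%:E)%E.
Proof.
have /andP[alpha0 _] := halpha.
have c0 : 0 <= alpha / K%:R by rewrite divr_ge0 // ltW.
have mE k : measurable_fun [set: T] (fun w => tnth (E w) k).
  exact: measurableT_comp (measurable_tnth k) (measurable_funPT E).
have mcE k : measurable_fun [set: T] (fun w => (alpha / K%:R)%:E * tnth (E w) k)%E.
  exact: emeasurable_funM.
have cE0 k w : (0 <= (alpha / K%:R)%:E * tnth (E w) k)%E.
  by rewrite mule_ge0 ?lee_fin // hE.
(* [hG] gives measurability on [e_values R K] only, so this set must be measurable and contain the
   range of [E]. *)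
have mGE : measurable_fun [set: T] (G \o E).
  apply: measurable_comp hG (measurable_funPT E).
    exact: measurable_e_values.
  by move=> _ [w _ <-]; exact: hE.
rewrite unlock.
apply: (@le_trans _ _
    (\int[P]_w \sum_(k <- enum N) (alpha / K%:R)%:E * tnth (E w) k)%E).
  apply: ge0_le_integral => //.
  - by move=> w _; rewrite lee_fin divr_ge0.
  - apply/measurable_EFinP.
    have mh := @measurable_fun_finset _ _ _ setT (false_discovery_proportion R N).
    exact: measurableT_comp mh mGE.
  - exact: emeasurable_sum.
  - by move=> w _; rewrite big_enum; exact: false_discovery_proportion_le.
(* Nonnegativity and measurability justify the exchange of sum and integral, whatever the joint law
   and even for infinite e-values. *)
rewrite ge0_integral_sum // big_enum /=.
apply: (@le_trans _ _ (\sum_(k in N) (alpha / K%:R)%:E)%E).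
  apply: lee_sum => k kN.
  rewrite ge0_integralZl_EFin //; last by move=> w _; exact: hE.
  by rewrite -[leRHS]mule1 lee_wpmul2l ?lee_fin // hEnull.
by rewrite sumEFin sumr_const lee_fin -[leLHS]mulr_natr mulrAC.
Qed.
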